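(* Consider a convex multiobjective optimization problem $\min (f_1(x),\dots,f_m(x))$ subject to $c_1(x)\ge 0,\dots,c_l(x)\ge 0$ in $x\in\mathbb{R}^n$, where all $f_j$ are convex real polynomials and all $c_i$ are concave real polynomials. Let $\mathcal{WP}$ be its weakly Pareto set. Suppose that the matrix polynomial $C(x)$ (defined in the context) is nonsingular, i.e. $\operatorname{rank} C(x)=l$ for all $x\in\mathbb{C}^n$. Let $C'(x)\in\mathbb{R}[x]^{l\times(n+l)}$ be a matrix polynomial with $C'(x)C(x)=I_l$, let $C_1'(x)$ be the submatrix formed by the first $n$ columns of $C'(x)$, and put, for $i=1,\dots,l$, $$\lambda_i(x,w)=\sum_{j=1}^m w_j\, e_i^T C_1'(x)\nabla f_j(x).$$ Then $\mathcal{WP}$ equals the set of all $x\in\mathbb{R}^n$ for which there exists $w=(w_1,\dots,w_m)\in\mathbb{R}^m$ such that $$\sum_{j=1}^m w_j\nabla f_j(x)=\sum_{i=1}^l\lambda_i(x,w)\nabla c_i(x),$$ $$c_i(x)\ge 0,\quad \lambda_i(x,w)\ge 0,\quad \lambda_i(x,w)\,c_i(x)=0\quad (i=1,\dots,l),$$ $$w_1\ge 0,\dots,w_m\ge 0,\quad w_1+\cdots+w_m=1.$$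
   Context: Let $K=\{x\in\mathbb{R}^n: c_1(x)\ge 0,\dots,c_l(x)\ge 0\}$. A point $x^*\in K$ is a weakly Pareto point if there is no $x\in K$ with $f_i(x)<f_i(x^* )$ for all $i=1,\dots,m$; the weakly Pareto set $\mathcal{WP}$ is the set of all weakly Pareto points. The matrix polynomial $C(x)$ is the $(n+l)\times l$ matrix whose $i$th column is $\begin{bmatrix}\nabla c_i(x)\\ c_i(x)e_i\end{bmatrix}$, i.e. its top $n\times l$ block is $[\nabla c_1(x)\ \cdots\ \nabla c_l(x)]$ and its bottom $l\times l$ block is $\operatorname{diag}(c_1(x),\dots,c_l(x))$; $e_i$ denotes the $i$th standard unit vector of $\mathbb{R}^l$. When $C(x)$ is nonsingular, a matrix polynomial $C'(x)$ with $C'(x)C(x)=I_l$ exists. *)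

(* Defs.v *)
From mathcomp Require Import all_boot all_order all_algebra.
From mathcomp Require Import mpoly complex.
From mathcomp Require Import boolp classical_sets reals convex.

Set Implicit Arguments.
Unset Strict Implicit.
Unset Printing Implicit Defensive.

Import Order.TTheory GRing.Theory Num.Theory.
Local Open Scope classical_set_scope.
Local Open Scope ring_scope.

Definition peval (K : comNzRingType) (n : nat) (p : {mpoly K[n]})
    (x : 'cV[K]_n) : K :=
  p.@[fun k => x k 0].

Definition peval_mx (K : comNzRingType) (n a b : nat)
    (P : 'M[{mpoly K[n]}]_(a, b)) (x : 'cV[K]_n) : 'M[K]_(a, b) :=
  map_mx (fun p => peval p x) P.

Definition grad (K : comNzRingType) (n : nat) (p : {mpoly K[n]}) :
    'cV[{mpoly K[n]}]_n :=
  \col_k mderiv k p.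

Definition complexify_mx (R : realType) (n a b : nat)
    (P : 'M[{mpoly R[n]}]_(a, b)) : 'M[{mpoly R[i][n]}]_(a, b) :=
  map_mx (map_mpoly (real_complex R)) P.

(* Full column rank at every complex, not merely every real, point. *)
Definition nonsingular_mxpoly (R : realType) (n a b : nat)
    (P : 'M[{mpoly R[n]}]_(a, b)) : Prop :=
  forall x : 'cV[R[i]]_n, \rank (peval_mx (complexify_mx P) x) = b.

Definition convex_mpoly (R : realType) (n : nat) (p : {mpoly R[n]}) : Prop :=
  convex_function [set: 'cV[R]_n] (fun x : 'cV[R]_n => peval p x).

Definition concave_mpoly (R : realType) (n : nat) (p : {mpoly R[n]}) : Prop :=
  convex_function [set: 'cV[R]_n] (fun x : 'cV[R]_n => - peval p x).

Definition feasible_set (R : realType) (n l : nat)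
    (c : 'I_l -> {mpoly R[n]}) : set 'cV[R]_n :=
  [set x | forall i, 0 <= peval (c i) x].

Definition weakly_pareto_set (R : realType) (n m l : nat)
    (f : 'I_m -> {mpoly R[n]}) (c : 'I_l -> {mpoly R[n]}) : set 'cV[R]_n :=
  [set x | feasible_set c x /\
     ~ exists y, feasible_set c y /\ forall j, peval (f j) y < peval (f j) x].

Definition constraint_mx (R : realType) (n l : nat)
    (c : 'I_l -> {mpoly R[n]}) : 'M[{mpoly R[n]}]_(n + l, l) :=
  col_mx (\matrix_(k, i) grad (c i) k 0) (diag_mx (\row_i c i)).

(* The entry (_ i 0) is e_i^T C_1'(x) grad f_j(x), with C_1' = lsubmx C'. *)
Definition lagrange_mult (R : realType) (n m l : nat)
    (f : 'I_m -> {mpoly R[n]}) (C' : 'M[{mpoly R[n]}]_(l, n + l))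
    (x : 'cV[R]_n) (w : 'cV[R]_m) (i : 'I_l) : R :=
  \sum_j w j 0 * (peval_mx (lsubmx C') x *m peval_mx (grad (f j)) x) i 0.

(* Main.v *)
(* Sufficiency of the KKT system is the usual gradient inequality for convex
   polynomials. For necessity, Gordan's alternative applied to the gradients of
   the objectives and of the active constraints gives Fritz John multipliers.
   At a feasible point x, the identity C'(x) C(x) = I says that C_1'(x) maps the
   gradient of an active c_i to e_i. Hence the active gradients are linearly
   independent, so the weights w do not all vanish, and applying C_1'(x) to the
   stationarity equation shows that the multipliers are the lambda_i(x, w). *)
Require Import Defs.
From mathcomp Require Import all_boot all_order all_algebra.
From mathcomp Require Import mpoly.
From mathcomp Require Import boolp classical_sets reals interval_inference convex.
From mathcomp Require Import polyrcf ring lra.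

Set Implicit Arguments.
Unset Strict Implicit.
Unset Printing Implicit Defensive.

Import Order.TTheory GRing.Theory Num.Theory.
Local Open Scope classical_set_scope.
Local Open Scope ring_scope.

(** * Properties that hold for all small positive reals *)

Section Near.
Variable R : rcfType.
Implicit Types P Q : R -> Prop.

(** A topology-free form of the limit [t -> 0+]: finitely many strict inequalities can be met by one
    common small step. *)
Definition near_right0 P := exists2 e : R, 0 < e & forall t, 0 < t < e -> P t.

Lemma near_right0_ex P : near_right0 P -> exists2 t, 0 < t & P t.
Proof.
case=> e e0 eP; exists (e / 2); first lra.
by apply: eP; lra.
Qed.

Lemma near_right0W P Q : (forall t, 0 < t -> P t -> Q t) ->
  near_right0 P -> near_right0 Q.
Proof.
move=> PQ [e e0 eP]; exists e => // t te.
by apply: PQ; [case/andP: te | apply: eP].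
Qed.

Lemma near_right0I P Q :
  near_right0 P -> near_right0 Q -> near_right0 (fun t => P t /\ Q t).
Proof.
move=> [e e0 eP] [e' e'0 eQ]; exists (Num.min e e'); first by rewrite lt_min e0.
move=> t; rewrite lt_min => /and3P[t0 te te'].
by split; [apply: eP | apply: eQ]; rewrite t0.
Qed.

Lemma near_right0_all (T : eqType) (s : seq T) (P : T -> R -> Prop) :
  (forall i, i \in s -> near_right0 (P i)) ->
  near_right0 (fun t => forall i, i \in s -> P i t).
Proof.
elim: s => [|a s IH] Ps; first by exists 1.
have Pa := Ps a (mem_head a s).
have /IH Pt : forall i, i \in s -> near_right0 (P i).
  by move=> i si; apply: Ps; rewrite inE si orbT.
apply: near_right0W (near_right0I Pa Pt) => t _ [Pat Pst] i.
by rewrite inE => /predU1P[->//|]; apply: Pst.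
Qed.

Lemma near_right0_lt1 : near_right0 (fun t => t < 1).
Proof. by exists 1 => // t /andP[]. Qed.

Lemma near_right0_poly (p : {poly R}) :
  0 < p.[0] -> near_right0 (fun t => 0 < p.[t]).
Proof.
move=> p0; have [d d0 dP] := poly_cont 0 p p0.
exists d => // t /andP[t0 td].
have := dP t; rewrite subr0 gtr0_norm// => /(_ td).
by rewrite ltr_norml => /andP[]; lra.
Qed.

End Near.

(** * The dot product of column vectors *)

Section Dot.
Variables (R : realFieldType) (n : nat).
Implicit Types (a : R) (u v w : 'cV[R]_n).

Definition dot u v : R := (u^T *m v) 0 0.

Lemma dotE u v : dot u v = \sum_k u k 0 * v k 0.
Proof. by rewrite /dot !mxE; apply: eq_bigr => k _; rewrite mxE. Qed.

Lemma dotDl u v w : dot (u + v) w = dot u w + dot v w.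
Proof. by rewrite /dot linearD mulmxDl mxE. Qed.

Lemma dotZl a u v : dot (a *: u) v = a * dot u v.
Proof. by rewrite /dot linearZ -scalemxAl mxE. Qed.

Lemma dotDr u v w : dot u (v + w) = dot u v + dot u w.
Proof. by rewrite /dot mulmxDr mxE. Qed.

Lemma dotZr a u v : dot u (a *: v) = a * dot u v.
Proof. by rewrite /dot -scalemxAr mxE. Qed.

Lemma dot0l v : dot 0 v = 0.
Proof. by rewrite -(scale0r 0) dotZl mul0r. Qed.

Lemma dot_suml (T : Type) (s : seq T) (P : pred T) (F : T -> 'cV[R]_n) v :
  dot (\sum_(i <- s | P i) F i) v = \sum_(i <- s | P i) dot (F i) v.
Proof.
by apply: (big_morph (fun u => dot u v)) => [x y|]; rewrite ?dotDl ?dot0l.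
Qed.

Lemma dot_gt0 v : v != 0 -> 0 < dot v v.
Proof.
move=> v0; rewrite lt_neqAle dotE sumr_ge0 ?andbT => [|k _]; last exact: sqr_ge0.
apply: contraNneq v0 => /esym/eqP.
rewrite psumr_eq0 => [/allP v0|k _]; last exact: sqr_ge0.
apply/eqP/colP => k; rewrite mxE.
by have := v0 k (mem_index_enum k); rewrite /= mulf_eq0 orbb => /eqP.
Qed.

End Dot.

(** * Gordan's theorem of the alternative *)

Section Gordan.
Variables (R : rcfType) (n : nat) (T : eqType).

(* Induction on the family: a positive d for the projections on the orthogonal
   complement of the first vector can be tilted towards that vector, and a
   dependency of the projections expresses a multiple of it by the others. *)
Lemma gordan (s : seq T) (v : T -> 'cV[R]_n) : uniq s ->
  (exists d, forall i, i \in s -> 0 < dot (v i) d) \/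
  (exists u : T -> R, [/\ forall i, 0 <= u i, exists2 i, i \in s & 0 < u i &
     \sum_(i <- s) u i *: v i = 0]).
Proof.
elim: s v => [|a s IH] v; first by left; exists 0.
case/andP=> a_s s_uniq.
have sum_upd (u : T -> R) (b : R) :
  \sum_(i <- a :: s) (if i == a then b else u i) *: v i =
  b *: v a + \sum_(i <- s) u i *: v i.
  rewrite big_cons eqxx; congr (_ + _); apply: eq_big_seq => i si.
  by rewrite ifN//; apply: contraNneq a_s => <-.
have extend (u : T -> R) (b : R) : (forall i, 0 <= u i) ->
    (exists2 i, i \in s & 0 < u i) -> 0 <= b ->
    b *: v a + \sum_(i <- s) u i *: v i = 0 ->
    exists u : T -> R, [/\ forall i, 0 <= u i, exists2 i, i \in a :: s & 0 < u i &
     \sum_(i <- a :: s) u i *: v i = 0].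
  move=> u0 [i si ui] b0 sum0; exists (fun i => if i == a then b else u i); split.
  - by move=> j; case: ifP.
  - exists i; first by rewrite inE si orbT.
    by rewrite ifN//; apply: contraNneq a_s => <-.
  - by rewrite sum_upd.
(* The induction hypothesis is used twice. This [d], for the unprojected vectors, is kept for the
   last case, where [v a] is a positive multiple of a nonnegative combination of them. *)
have [[d dP]|[u [u0 uex usum]]] := IH v s_uniq; last first.
  by right; apply: (extend u 0) => //; rewrite scale0r add0r.
have [va0|va0] := eqVneq (v a) 0.
  right; exists (fun i => if i == a then 1 else 0); split.
  - by move=> i; case: ifP.
  - by exists a; rewrite ?mem_head ?eqxx.
  - by rewrite sum_upd va0 scaler0 add0r big1// => i _; rewrite scale0r.
have pa := dot_gt0 va0.
pose k i := dot (v i) (v a) / dot (v a) (v a).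
have kE i : k i * dot (v a) (v a) = dot (v i) (v a) by rewrite divfK ?gt_eqF.
have [[d' d'P]|[u [u0 uex usum]]] := IH (fun i => v i + (- k i) *: v a) s_uniq.
  left.
  (* Subtracting [b *: v a] makes [d'] orthogonal to [v a]. After adding [t *: v a], the product
     with [v a] is [t * dot (v a) (v a)] and the product with [v i] is [(q i).[t]]. *)
  pose b := dot (v a) d' / dot (v a) (v a).
  have bE : b * dot (v a) (v a) = dot (v a) d' by rewrite divfK ?gt_eqF.
  pose q i : {poly R} := (dot (v i + (- k i) *: v a) d')%:P + dot (v i) (v a) *: 'X.
  have /near_right0_ex[t t0 tP] :
      near_right0 (fun t => forall i, i \in s -> 0 < (q i).[t]).
    apply: near_right0_all => i si; apply: near_right0_poly.
    by rewrite !hornerE ?mulr0 ?addr0 d'P.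
  exists (d' + (t - b) *: v a) => i.
  rewrite inE => /predU1P[->|/tP].
    by rewrite dotDr dotZr mulrBl bE addrC subrK mulr_gt0.
  rewrite !hornerE dotDr dotZr dotDl dotZl -bE -(kE i); congr (0 < _); ring.
have {}usum : \sum_(i <- s) u i *: v i = (\sum_(i <- s) u i * k i) *: v a.
  apply/eqP; rewrite -subr_eq0 scaler_suml -sumrB; apply/eqP.
  apply: etrans usum; apply: eq_bigr => i _.
  by rewrite scalerDr scalerA mulrN scaleNr.
set al := \sum_(i <- s) u i * k i in usum.
(* If [al <= 0], moving [al *: v a] to the other side gives a nonnegative dependency. If [al > 0],
   positivity on the [v i] forces positivity on [v a]. *)
have [al0|al0] := leP al 0.
  right; apply: (extend u (- al)) => //; first by rewrite oppr_ge0.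
  by rewrite usum scaleNr addNr.
left; exists d => i; rewrite inE => /predU1P[->|]; last exact: dP.
rewrite -(pmulr_rgt0 _ al0) -dotZl -usum dot_suml.
have [i0 si0 ui0] := uex.
rewrite (big_rem i0)//= ltr_pwDl//; first by rewrite dotZl mulr_gt0// dP.
rewrite big_seq; apply: sumr_ge0 => j /mem_rem sj.
by rewrite dotZl mulr_ge0// ltW// dP.
Qed.

End Gordan.

(** * Taylor expansion of a polynomial along a line *)

Section Taylor.
Variables (R : comNzRingType) (n : nat).

Lemma pevalN (p : {mpoly R[n]}) x : peval (- p) x = - peval p x.
Proof. exact: mevalN. Qed.

Lemma pevalD (p q : {mpoly R[n]}) x : peval (p + q) x = peval p x + peval q x.
Proof. exact: mevalD. Qed.

Lemma pevalM (p q : {mpoly R[n]}) x : peval (p * q) x = peval p x * peval q x.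
Proof. exact: mevalM. Qed.

(** The property holds for constants and variables and is stable under sums and products. The
    remainder factor is a polynomial in [t], so its continuity settles signs for small [t]. *)
Lemma peval_line_taylor (p : {mpoly R[n]}) (x d : 'cV[R]_n) :
  exists q : {poly R}, forall t, peval p (x + t *: d) =
    peval p x + t * (\sum_k peval (mderiv k p) x * d k 0) + t ^+ 2 * q.[t].
Proof.
pose P (p : {mpoly R[n]}) := exists q : {poly R}, forall t,
  peval p (x + t *: d) =
    peval p x + t * (\sum_k peval (mderiv k p) x * d k 0) + t ^+ 2 * q.[t].
rewrite -/(P p).
have PC a : P a%:MP.
  exists 0 => t; rewrite /peval !mevalC horner0 mulr0 addr0 big1 ?mulr0 ?addr0//.
  by move=> k _; rewrite mderivC meval0 mul0r.
have PX i : P 'X_i.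
  exists 0 => t; rewrite /peval !mevalXU horner0 mulr0 addr0 !mxE.
  rewrite (bigD1 i)//= big1 ?addr0; last first.
    by move=> k ki; rewrite mderivX mnmE eq_sym (negPf ki) scale0r meval0 mul0r.
  rewrite mderivX mnmE eqxx scale1r.
  rewrite (_ : (U_(i) - U_(i))%MM = 0%MM) ?mpolyX0 ?meval1 ?mul1r//.
  by apply/mnmP => k; rewrite !mnmE subnn.
have PD (p1 p2 : {mpoly R[n]}) : P p1 -> P p2 -> P (p1 + p2).
  move=> [q1 q1P] [q2 q2P]; exists (q1 + q2) => t.
  rewrite pevalD q1P q2P hornerD.
  under [in RHS]eq_bigr do rewrite mderivD pevalD mulrDl.
  rewrite big_split /=; ring.
have PM (p1 p2 : {mpoly R[n]}) : P p1 -> P p2 -> P (p1 * p2).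
  move=> [q1 q1P] [q2 q2P].
  pose D (p0 : {mpoly R[n]}) := \sum_k peval (mderiv k p0) x * d k 0.
  (* These are the terms of the product of the two expansions that are divisible by [t ^+ 2]. *)
  exists ((D p1 * D p2)%:P + (peval p1 x)%:P * q2 + (peval p2 x)%:P * q1
     + (D p1 *: 'X) * q2 + (D p2 *: 'X) * q1 + 'X^2 * q1 * q2) => t.
  rewrite !pevalM q1P q2P -/(D p1) -/(D p2) !hornerE.
  have -> : \sum_k peval (mderiv k (p1 * p2)) x * d k 0 =
            peval p2 x * D p1 + peval p1 x * D p2.
    rewrite !mulr_sumr -big_split; apply: eq_bigr => k _ /=.
    rewrite mderivM pevalD !pevalM; ring.
  ring.
rewrite [p]mpolyE; apply: (big_ind P) => [|p1 p2|m _];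
  [by rewrite -mpolyC0|exact: PD|].
rewrite -mul_mpolyC; apply: (PM) => //.
rewrite mpolyXE_id; apply: (big_ind P) => [|p1 p2|i _];
  [by rewrite -mpolyC1|exact: PM|].
elim: (m i) => [|k IH]; first by rewrite expr0 -mpolyC1.
by rewrite exprS; apply: PM.
Qed.

End Taylor.

(** * First-order behaviour along a ray *)

Section FirstOrder.
Variables (R : rcfType) (n : nat).
Implicit Types (p : {mpoly R[n]}) (x y d : 'cV[R]_n).

Lemma peval_mx_gradN p x : peval_mx (grad (- p)) x = - peval_mx (grad p) x.
Proof. by apply/colP => k; rewrite !mxE mderivN pevalN. Qed.

Lemma peval_line_grad p x d : exists q : {poly R}, forall t,
  peval p (x + t *: d) =
    peval p x + t * (dot (peval_mx (grad p) x) d + t * q.[t]).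
Proof.
have [q qP] := peval_line_taylor p x d; exists q => t.
have -> : dot (peval_mx (grad p) x) d = \sum_k peval (mderiv k p) x * d k 0.
  by rewrite dotE; apply: eq_bigr => k _; rewrite !mxE.
by rewrite qP; ring.
Qed.

(** The increment is [t] times a polynomial in [t] whose value at 0 is the directional
    derivative. *)
Lemma near_right0_peval_lt p x d : 0 < dot (peval_mx (grad p) x) d ->
  near_right0 (fun t => peval p x < peval p (x + t *: d)).
Proof.
have [q qP] := peval_line_grad p x d => b0.
have : near_right0
    (fun t => 0 < ((dot (peval_mx (grad p) x) d)%:P + 'X * q).[t]).
  by apply: near_right0_poly; rewrite !hornerE ?mul0r ?addr0.
apply: near_right0W => t t0; rewrite !hornerE qP => ?.
by rewrite ltrDl mulr_gt0.
Qed.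

Lemma near_right0_peval_gt0 p x d : 0 < peval p x ->
  near_right0 (fun t => 0 < peval p (x + t *: d)).
Proof.
have [q qP] := peval_line_grad p x d => b0.
have : near_right0 (fun t => 0 < ((peval p x)%:P +
    'X * ((dot (peval_mx (grad p) x) d)%:P + 'X * q)).[t]).
  by apply: near_right0_poly; rewrite !hornerE ?mul0r ?addr0.
by apply: near_right0W => t t0; rewrite !hornerE qP.
Qed.

End FirstOrder.

(** * Gradient inequalities for convex and concave polynomials *)

Section Convex.
Variables (R : realType) (n : nat).
Implicit Types (p : {mpoly R[n]}) (x y : 'cV[R]_n).

(** If the slope at [x] towards [y] exceeded that of the chord, then by Taylor expansion [p] would
    lie above the chord for small [t]. *)
Lemma convex_mpoly_grad p x y : convex_mpoly p ->
  dot (peval_mx (grad p) x) (y - x) <= peval p y - peval p x.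
Proof.
move=> p_conv; rewrite leNgt; apply/negP => lt_b.
set b := dot _ _ in lt_b.
have [q qP] := peval_line_grad p x (y - x).
have : near_right0
    (fun t => 0 < ((b - (peval p y - peval p x))%:P + 'X * q).[t]).
  by apply: near_right0_poly; rewrite !hornerE ?mul0r ?addr0 subr_gt0.
move=> /(near_right0I (near_right0_lt1 R))/near_right0_ex[t t0 [t1]].
rewrite !hornerE => tq.
have := p_conv (Itv01 (ltW t0) (ltW t1)) y x.
rewrite !inE => /(_ Logic.I Logic.I).
rewrite convRE/= /conv/= /unstable.onem.
have -> : t *: y + (1 - t) *: x = x + t *: (y - x).
  by rewrite scalerBr scalerBl scale1r addrCA.
rewrite qP -/b => le_t.
have : t * (b - (peval p y - peval p x) + t * q.[t]) <= 0 by lra.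
by rewrite pmulr_rle0// leNgt tq.
Qed.

Lemma concave_mpoly_grad p x y : concave_mpoly p ->
  peval p y - peval p x <= dot (peval_mx (grad p) x) (y - x).
Proof.
move=> p_conc; have : convex_mpoly (- p).
  rewrite /convex_mpoly (_ : (fun _ => _) = (fun x => - peval p x))//.
  by apply: funext => z; rewrite pevalN.
move=> /(@convex_mpoly_grad _ x y).
rewrite peval_mx_gradN !pevalN -scaleN1r dotZl; lra.
Qed.

End Convex.

(** * Multiplier formula and Fritz John conditions *)

Section Multipliers.
Variables (R : realType) (n m l : nat).
Variables (f : 'I_m -> {mpoly R[n]}) (c : 'I_l -> {mpoly R[n]}).
Variable C' : 'M[{mpoly R[n]}]_(l, n + l).

Lemma lagrange_multE x w i : lagrange_mult f C' x w i =
  (peval_mx (lsubmx C') x *m \sum_j w j 0 *: peval_mx (grad (f j)) x) i 0.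
Proof.
rewrite mulmx_sumr summxE; apply: eq_bigr => j _.
by rewrite -scalemxAr [RHS]mxE.
Qed.

Hypothesis C'C : C' *m constraint_mx c = 1%:M.

(** In column [i] of [C'C], the lower block contributes only multiples of [c i], which vanish at
    [x]. *)
Lemma lsubmx_active_grad x i : peval (c i) x = 0 ->
  peval_mx (lsubmx C') x *m peval_mx (grad (c i)) x = delta_mx i 0.
Proof.
move=> ci0; apply/colP => j.
have := C'C; rewrite -[C']hsubmxK mul_row_col hsubmxK => /matrixP/(_ j i).
move/(congr1 (fun p => peval p x)).
rewrite mxE pevalD.
have -> : peval ((rsubmx C' *m diag_mx (\row_i c i)) j i) x = 0.
  by rewrite mul_mx_diag !mxE pevalM ci0 mulr0.
rewrite addr0 !mxE eqxx andbT /peval raddf_sum mevalMn meval1 => <-.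
by apply: eq_bigr => k _; rewrite !mxE -mevalM.
Qed.

(** Reading off coefficients in this way serves both to exclude [w = 0] and to identify the
    multipliers. *)
Lemma lsubmx_active_sum (x : 'cV[R]_n) (u : 'I_l -> R) (i : 'I_l) :
  (peval_mx (lsubmx C') x *m
    \sum_(i | peval (c i) x == 0) u i *: peval_mx (grad (c i)) x) i 0 =
  if peval (c i) x == 0 then u i else 0.
Proof.
rewrite mulmx_sumr summxE.
rewrite (eq_bigr (fun k => u k * (i == k)%:R)); last first.
  move=> k /eqP ck; rewrite -scalemxAr lsubmx_active_grad//.
  by rewrite !mxE eqxx andbT.
rewrite big_mkcond (bigD1 i)//= eqxx mulr1 big1 ?addr0// => k ki.
by rewrite [i == k]eq_sym (negPf ki) mulr0 if_same.
Qed.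

(* Gordan's alternative for the objectives and the active constraints: a
   common descent direction would contradict weak Pareto optimality. *)
Lemma weakly_pareto_fritz_john (x : 'cV[R]_n) : weakly_pareto_set f c x ->
  exists (w : 'I_m -> R) (u : 'I_l -> R), [/\ forall j, 0 <= w j,
    forall i, 0 <= u i,
    (exists j, 0 < w j) \/ (exists2 i, peval (c i) x = 0 & 0 < u i) &
    \sum_j w j *: peval_mx (grad (f j)) x =
    \sum_(i | peval (c i) x == 0) u i *: peval_mx (grad (c i)) x].
Proof.
move=> [xK xWP].
pose act (k : 'I_m + 'I_l) := if k is inr i then peval (c i) x == 0 else true.
(* With this sign, a positive product with [d] means descent for objectives and ascent for active
   constraints. *)
pose v (k : 'I_m + 'I_l) := match k with
  | inl j => - peval_mx (grad (f j)) x
  | inr i => peval_mx (grad (c i)) x end.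
have := @gordan R n _ (filter act (index_enum _)) v.
rewrite filter_uniq ?index_enum_uniq// => /(_ isT)[[d dP]|[u [u0 [k]]]].
  have dP' k : act k -> 0 < dot (v k) d.
    by move=> ak; apply: dP; rewrite mem_filter ak mem_index_enum.
  have nf : near_right0 (fun t => forall j, j \in index_enum 'I_m ->
      peval (f j) (x + t *: d) < peval (f j) x).
    apply: near_right0_all => j _.
    have : near_right0 (fun t => peval (- f j) x < peval (- f j) (x + t *: d)).
      by apply: near_right0_peval_lt; rewrite peval_mx_gradN; apply: (dP' (inl j)).
    by apply: near_right0W => t _; rewrite !pevalN ltrN2.
  have nc : near_right0 (fun t => forall i, i \in index_enum 'I_l ->
      0 < peval (c i) (x + t *: d)).
    apply: near_right0_all => i _.
    (* An active constraint increases from 0; an inactive one stays positive by continuity. *)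
    have [ci0|ci0] := eqVneq (peval (c i) x) 0.
      rewrite -{1}ci0; apply: near_right0_peval_lt.
      by apply: (dP' (inr i)); rewrite /= ci0.
    by apply: near_right0_peval_gt0; rewrite lt_neqAle eq_sym ci0 xK.
  have [t t0 [tf tc]] := near_right0_ex (near_right0I nf nc).
  case: xWP; exists (x + t *: d); split => [i|j]; last by rewrite tf ?mem_index_enum.
  by rewrite ltW// tc ?mem_index_enum.
rewrite mem_filter => /andP[ak _] uk.
rewrite big_filter big_sumType /= => sum0.
exists (fun j => u (inl j)), (fun i => u (inr i)); split => //.
  case: k ak uk => [j|i] /= ak uk; first by left; exists j.
  by right; exists i => //; apply/eqP.
apply/esym/eqP; rewrite -subr_eq0 addrC -sumrN; apply/eqP.
apply: etrans sum0; congr (_ + _).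
by apply: eq_bigr => j _; rewrite scalerN.
Qed.

End Multipliers.

(** * Necessity and sufficiency of the KKT system *)

Theorem mainTheorem1 (R : realType) (n m l : nat)
    (f : 'I_m -> {mpoly R[n]}) (c : 'I_l -> {mpoly R[n]})
    (C' : 'M[{mpoly R[n]}]_(l, n + l))
    (f_convex : forall j, convex_mpoly (f j))
    (c_concave : forall i, concave_mpoly (c i))
    (C_nonsingular : nonsingular_mxpoly (constraint_mx c))
    (C'C : C' *m constraint_mx c = 1%:M) :
  weakly_pareto_set f c =
  [set x : 'cV[R]_n | exists w : 'cV[R]_m,
    [/\ \sum_j w j 0 *: peval_mx (grad (f j)) x =
          \sum_i lagrange_mult f C' x w i *: peval_mx (grad (c i)) x,
        forall i, [/\ 0 <= peval (c i) x,
                      0 <= lagrange_mult f C' x w i &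
                      lagrange_mult f C' x w i * peval (c i) x = 0],
        forall j, 0 <= w j 0 &
        \sum_j w j 0 = 1]].
Proof.
apply/seteqP; split => x /=.
  move=> xWP; have [w [u [w0 u0 wu_neq0 wu]]] := weakly_pareto_fritz_john xWP.
  have xK := xWP.1.
  have sum_w : 0 < \sum_j w j.
    rewrite lt_neqAle sumr_ge0 ?andbT//; apply/eqP => /esym/eqP.
    rewrite psumr_eq0// => /allP w_eq0.
    have {}w_eq0 j : w j = 0 by apply/eqP/w_eq0; rewrite mem_index_enum.
    (* If [w] vanished, some active [u i] would be positive, yet the upper block of [C'] recovers it
       from a zero sum. *)
    case: wu_neq0 => [[j]|[i ci0]]; first by rewrite w_eq0 ltxx.
    have := lsubmx_active_sum C'C x u i; rewrite ci0 eqxx => <-.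
    by rewrite -wu big1 ?mulmx0 ?mxE ?ltxx// => j _; rewrite w_eq0 scale0r.
  set W := \sum_j w j in sum_w.
  (* The Fritz John system is homogeneous, so the weights can be normalized to sum 1. *)
  pose w' : 'cV[R]_m := \col_j (W^-1 * w j).
  have w'E : \sum_j w' j 0 *: peval_mx (grad (f j)) x =
      \sum_(i | peval (c i) x == 0) (W^-1 * u i) *: peval_mx (grad (c i)) x.
    under eq_bigr do rewrite mxE -scalerA.
    under [RHS]eq_bigr do rewrite -scalerA.
    by rewrite -!scaler_sumr wu.
  have lE i : lagrange_mult f C' x w' i =
      if peval (c i) x == 0 then W^-1 * u i else 0.
    by rewrite lagrange_multE w'E (lsubmx_active_sum C'C).
  exists w'; split => [|i|j|].
  - rewrite w'E big_mkcond; apply: eq_bigr => i _; rewrite lE.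
    by case: ifP => // _; rewrite scale0r.
  - rewrite lE; split; first exact: xK.
      by case: ifP => // _; rewrite mulr_ge0// invr_ge0 ltW.
    by case: eqP => [->|_]; rewrite ?mulr0 ?mul0r.
  - by rewrite mxE mulr_ge0// invr_ge0 ltW.
  - under eq_bigr do rewrite mxE.
    by rewrite -mulr_sumr mulVf// gt_eqF.
move=> [w [stat kkt w0 w1]]; split; first by move=> i; case: (kkt i).
move=> [y [yK y_lt]].
have : \sum_j w j 0 * (peval (f j) y - peval (f j) x) < 0.
  have [j wj] : exists j, 0 < w j 0.
    apply/not_existsP => w_le0; have := @ltr01 R; rewrite -w1 big1 ?ltxx// => j _.
    by apply/eqP; rewrite eq_le w0 andbT leNgt; apply/negP/w_le0.
  rewrite (bigD1 j)//= ltr_nwDl//; first by rewrite nmulr_llt0 ?subr_lt0.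
  by apply: sumr_le0 => k _; rewrite mulr_ge0_le0// subr_le0 ltW.
apply/negP; rewrite -leNgt.
(* The chain bounds the weighted objective change below by the stationary gradient paired with
   [y - x], then by the weighted constraint change, which is nonnegative by complementarity and
   feasibility of [y]. *)
apply: (@le_trans _ _ (\sum_i
  lagrange_mult f C' x w i * (peval (c i) y - peval (c i) x))).
  apply: sumr_ge0 => i _; case: (kkt i) => _ l0 lc.
  by rewrite mulrBr lc subr0 mulr_ge0// yK.
apply: (@le_trans _ _ (dot (\sum_j w j 0 *: peval_mx (grad (f j)) x) (y - x))).
  rewrite stat dot_suml; apply: ler_sum => i _.
  by rewrite dotZl ler_wpM2l ?concave_mpoly_grad//; case: (kkt i).
rewrite dot_suml; apply: ler_sum => j _.
by rewrite dotZl ler_wpM2l// convex_mpoly_grad.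
Qed.
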